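(* Let $\overset{\frown}{AC}$ be an arc of a circle less than a semicircumference, and let $s$ be its length. Let $b = AC$ be the length of its chord and let $c$ be its sine, i.e. the length of the perpendicular from $A$ to the diameter of the circle through $C$. Then $$b + \frac{1}{3}(b - c) \;<\; s \;<\; b + \frac{1}{3}(b-c)\cdot\frac{4b + c}{2b + 3c}\,.$$
   Context: The sine of a circular arc less than a semicircle is the length of the perpendicular from one extremity of the arc to the circle's diameter through the other extremity (i.e. the radius times the modern sine of the central angle). *)

(* Defs.v *)
From Stdlib Require Import Reals.
Open Scope R_scope.

Definition point : Type := (R * R)%type.

Definition distance (P Q : point) : R := dist_euc (fst P) (snd P) (fst Q) (snd Q).

(* For [theta > 0] the arc is traversed counterclockwise as [t] runs over
   [0, 1], and for [theta < 0] clockwise. *)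
Definition circle_arc (O : point) (r alpha theta t : R) : point :=
  (fst O + r * cos (alpha + t * theta), snd O + r * sin (alpha + t * theta)).

(* The vertices are [g (u 0), ..., g (u (S n))]; [sum_f_R0 _ n] has [n + 1]
   terms, one for each of the [n + 1] sides. *)
Definition inscribed_polygon_length (g : R -> point) (a b l : R) : Prop :=
  exists (n : nat) (u : nat -> R),
    u 0%nat = a /\ u (S n) = b /\
    (forall i : nat, (i <= n)%nat -> u i <= u (S i)) /\
    l = sum_f_R0 (fun i => distance (g (u i)) (g (u (S i)))) n.

Definition is_curve_length (g : R -> point) (a b s : R) : Prop :=
  is_lub (inscribed_polygon_length g a b) s.

Definition on_line (P Q X : point) : Prop :=
  exists t : R, X = (fst P + t * (fst Q - fst P), snd P + t * (snd Q - snd P)).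

Definition perpendicular (A F P Q : point) : Prop :=
  (fst A - fst F) * (fst Q - fst P) + (snd A - snd F) * (snd Q - snd P) = 0.

Definition is_perpendicular_foot (A P Q F : point) : Prop :=
  on_line P Q F /\ perpendicular A F P Q.

(* The diameter through [C] spans the line through the center [O] and [C]. *)
Definition is_arc_sine (O A C : point) (c : R) : Prop :=
  exists F : point, is_perpendicular_foot A O C F /\ c = distance A F.

(* Main.v *)
(** The supremum of the inscribed polygons is [r |theta|], so with the
    half-angle [x = |theta| / 2] one has [s = 2 r x], [b = 2 r sin x] and
    [c = 2 r sin x cos x].  Divided by [r], both bounds become inequalities
    between functions vanishing at [0], and with [k = cos x] the derivatives of
    the differences are
    [4 (1 - k)^2]  and  [18 (1 - k)^3 (1 + k) / (6 + 9 k)^2]. *)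
Require Import Defs.
From Stdlib Require Import Reals Lra Lia.
From Coquelicot Require Import Coquelicot.
Open Scope R_scope.

(** Positivity is asked on the open interval only, because both derivatives to which this is applied
    vanish at [0]. *)
Lemma increment_pos (f f' : R -> R) (a b : R) :
  a < b ->
  (forall x, a <= x <= b -> is_derive f x (f' x)) ->
  (forall x, a < x < b -> 0 < f' x) ->
  f a < f b.
Proof.
  intros hab hd hpos.
  destruct (MVT_cor2 f f' a b hab) as [x [hx hxab]].
  { intros x hx. apply is_derive_Reals, hd, hx. }
  pose proof (Rmult_lt_0_compat _ (b - a) (hpos x hxab) ltac:(lra)). lra.
Qed.

Lemma cos_lt_1 (x : R) : 0 < x <= PI -> cos x < 1.
Proof.
  intros hx. rewrite <- cos_0. apply cos_decreasing_1; lra.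
Qed.

(** The lower bound for [s], multiplied by [3 / r]. *)
Lemma sin_sub_sin_double_lt (x : R) :
  0 < x <= PI -> 8 * sin x - 2 * sin x * cos x < 6 * x.
Proof.
  intros hx.
  assert (H := increment_pos (fun t => 6 * t - 8 * sin t + 2 * sin t * cos t)
                 (fun t => 4 * (1 - cos t) ^ 2) 0 x).
  cbv beta in H. rewrite sin_0 in H.
  enough (6 * 0 - 8 * 0 + 2 * 0 * cos 0
          < 6 * x - 8 * sin x + 2 * sin x * cos x) by lra.
  apply H; [lra | |].
  - intros t _. auto_derive; [exact I |].
    pose proof (sin2_cos2 t) as E. unfold Rsqr in E. nra.
  - intros t ht. pose proof (cos_lt_1 t ltac:(lra)).
    assert (0 < (1 - cos t) ^ 2) by (apply pow_lt; lra). lra.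
Qed.

(** The upper bound for [s], divided by [2 * r]: with [k = cos x], the factor of [sin x] is
    [1 + (1 - k) (4 + k) / (3 (2 + 3 k))]. *)
Lemma lt_sin_mul_rational_cos (x : R) :
  0 < x <= PI / 2 ->
  x < sin x * (10 + 6 * cos x - cos x ^ 2) / (6 + 9 * cos x).
Proof.
  intros hx. pose proof PI_RGT_0.
  assert (H1 := increment_pos
    (fun t => sin t * (10 + 6 * cos t - cos t ^ 2) / (6 + 9 * cos t) - t)
    (fun t => 18 * (1 - cos t) ^ 3 * (1 + cos t) / (6 + 9 * cos t) ^ 2) 0 x).
  cbv beta in H1. rewrite sin_0, cos_0 in H1.
  enough (0 * (10 + 6 * 1 - 1 ^ 2) / (6 + 9 * 1) - 0
          < sin x * (10 + 6 * cos x - cos x ^ 2) / (6 + 9 * cos x) - x) by lra.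
  apply H1; [lra | |].
  - intros t ht. assert (0 <= cos t) by (apply cos_ge_0; lra).
    auto_derive; [lra |].
    assert (E : sin t * sin t = 1 - cos t * cos t).
    { pose proof (sin2_cos2 t) as E. unfold Rsqr in E. lra. }
    (* In the combined fraction [sin t] survives only as a square, so the Pythagorean identity
       leaves a rational identity in [cos t]. *)
    apply Rminus_diag_uniq. field_simplify; [| lra].
    replace (sin t ^ 2) with (1 - cos t * cos t) by (rewrite <- E; ring).
    field. pose proof (pow2_ge_0 (cos t)). lra.
  - intros t ht. assert (0 < cos t) by (apply cos_gt_0; lra).
    pose proof (cos_lt_1 t ltac:(lra)).
    apply Rdiv_lt_0_compat; [| apply pow_lt; lra].
    apply Rmult_lt_0_compat; [| lra].
    apply Rmult_lt_0_compat; [lra |]. apply pow_lt; lra.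
Qed.

Lemma Rabs_sin_le (x : R) : Rabs (sin x) <= Rabs x.
Proof.
  assert (H : forall y, 0 <= y -> Rabs (sin y) <= y).
  { intros y [hy | <-]; [| rewrite sin_0, Rabs_R0; lra].
    apply Rabs_le. split; [| left; now apply sin_lt_x].
    (* For [- y <= sin y]: the sine is nonnegative up to [PI], and beyond it [-1 <= sin y]
       suffices. *)
    destruct (Rle_dec y PI).
    - pose proof (sin_ge_0 y). lra.
    - pose proof (SIN_bound y). pose proof PI2_3_2. lra. }
  destruct (Rle_dec 0 x).
  - rewrite (Rabs_right x) by lra. now apply H.
  - rewrite (Rabs_left x), <- Rabs_Ropp, <- sin_neg by lra. apply H. lra.
Qed.

(** With [m] the mean of the two angles and [h] half their difference, the chord is [2 r sin h]
    times the unit vector [(sin m, - cos m)]. *)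
Lemma distance_circle_arc (O : point) (r alpha theta t t' : R) :
  0 <= r ->
  distance (circle_arc O r alpha theta t) (circle_arc O r alpha theta t')
  = 2 * r * Rabs (sin ((t' - t) * theta / 2)).
Proof.
  intros hr. unfold distance, dist_euc, circle_arc, fst, snd.
  set (h := (t' - t) * theta / 2).
  set (m := alpha + (t + t') * theta / 2).
  replace (alpha + t * theta) with (m - h) by (unfold m, h; field).
  replace (alpha + t' * theta) with (m + h) by (unfold m, h; field).
  rewrite cos_minus, cos_plus, sin_minus, sin_plus.
  rewrite <- (Rabs_pos_eq (2 * r)) by lra.
  rewrite <- Rabs_mult, <- sqrt_Rsqr_abs. f_equal.
  pose proof (sin2_cos2 m) as E. unfold Rsqr in *.
  transitivity (4 * r * r * (sin h * sin h) * (sin m * sin m + cos m * cos m)).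
  - ring.
  - rewrite E. ring.
Qed.

(** Each side is at most [r |theta|] times its parameter increment, and the increments telescope. *)
Lemma inscribed_circle_arc_le (O : point) (r alpha theta a b l : R) :
  0 <= r ->
  inscribed_polygon_length (circle_arc O r alpha theta) a b l ->
  l <= r * Rabs theta * (b - a).
Proof.
  intros hr [n [u [<- [<- [hu ->]]]]].
  induction n as [| n IH].
  - simpl. rewrite distance_circle_arc by lra.
    pose proof (Rabs_sin_le ((u 1%nat - u 0%nat) * theta / 2)) as H.
    specialize (hu 0%nat (le_n _)).
    unfold Rdiv in H. rewrite !Rabs_mult in H.
    rewrite (Rabs_pos_eq (u 1%nat - _)), (Rabs_pos_eq (/ 2)) in H by lra.
    pose proof (Rmult_le_compat_l (2 * r) _ _ ltac:(lra) H).
    unfold Rdiv. lra.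
  - rewrite tech5.
    specialize (IH (fun i hi => hu i (le_S _ _ hi))).
    specialize (hu (S n) (le_n _)).
    rewrite distance_circle_arc by lra.
    pose proof (Rabs_sin_le ((u (S (S n)) - u (S n)) * theta / 2)) as H.
    unfold Rdiv in H. rewrite !Rabs_mult in H.
    rewrite (Rabs_pos_eq (u (S (S n)) - _)), (Rabs_pos_eq (/ 2)) in H by lra.
    pose proof (Rmult_le_compat_l (2 * r) _ _ ltac:(lra) H).
    unfold Rdiv. lra.
Qed.

(** Equal subdivision gives [n + 1] equal sides; these polygons will show that no number below
    [r |theta|] is an upper bound. *)
Lemma regular_polygon_inscribed (O : point) (r alpha theta : R) (n : nat) :
  0 <= r ->
  inscribed_polygon_length (circle_arc O r alpha theta) 0 1
    (INR (S n) * (2 * r * Rabs (sin (theta / (2 * INR (S n)))))).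
Proof.
  intros hr. pose proof (lt_0_INR (S n) ltac:(lia)) as hn.
  exists n, (fun i => INR i / INR (S n)).
  repeat split.
  - simpl (INR 0). field. lra.
  - field. lra.
  - intros i _. apply Rmult_le_compat_r; [left; now apply Rinv_0_lt_compat |].
    apply le_INR. lia.
  - rewrite (sum_eq _ (fun _ => 2 * r * Rabs (sin (theta / (2 * INR (S n)))))).
    + rewrite sum_cte. ring.
    + intros i _. rewrite distance_circle_arc by lra.
      do 3 f_equal. rewrite (S_INR i). field. lra.
Qed.

Lemma circle_arc_length (O : point) (r alpha theta s : R) :
  0 < r -> theta <> 0 ->
  is_curve_length (circle_arc O r alpha theta) 0 1 s ->
  s = r * Rabs theta.
Proof.
  intros hr htheta [hub hlub].
  apply Rle_antisym.
  - apply hlub. intros l hl.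
    apply inscribed_circle_arc_le in hl; lra.
  - apply Rnot_lt_le. intros hlt.
    pose proof (Rabs_pos_lt _ htheta) as hpos.
    assert (hrt : 0 < r * Rabs theta) by now apply Rmult_lt_0_compat.
    (* The tolerance is the relative gap [1 - s / (r |theta|)]: a regular polygon has length
       [r |theta| |sin h / h|], which exceeds [s] once [sin h / h] is within that tolerance of
       [1]. *)
    destruct (derivable_pt_lim_sin_0 ((r * Rabs theta - s) / (r * Rabs theta)))
      as [d hd].
    { apply Rdiv_lt_0_compat; lra. }
    (* Enough sides to bring the half-angle [h] of one side below [d] in absolute value. *)
    destruct (INR_unbounded (Rabs theta / d)) as [n hn].
    pose proof (cond_pos d) as hd0.
    pose proof (lt_0_INR (S n) ltac:(lia)) as hSn.
    assert (hle : INR n <= INR (S n)) by (apply le_INR; lia).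
    set (N := INR (S n)) in *.
    set (h := theta / (2 * N)).
    assert (hh : h <> 0).
    { unfold h, Rdiv. apply Rmult_integral_contrapositive_currified; [easy |].
      apply Rinv_neq_0_compat. lra. }
    assert (habs : Rabs h * (2 * N) = Rabs theta).
    { unfold h, Rdiv. rewrite Rabs_mult, Rabs_inv, (Rabs_pos_eq (2 * N)) by lra.
      field. lra. }
    pose proof (Rabs_pos_lt _ hh) as hhpos.
    assert (hsmall : Rabs h < d).
    { assert (hNd : Rabs theta < N * d).
      { apply (Rmult_lt_reg_r (/ d)); [now apply Rinv_0_lt_compat |].
        unfold Rdiv in hn. field_simplify (N * d * / d); lra. }
      apply (Rmult_lt_reg_r (2 * N)); [lra |]. rewrite habs.
      pose proof (Rmult_lt_0_compat _ _ hSn hd0). lra. }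
    specialize (hd h hh hsmall).
    rewrite Rplus_0_l, sin_0, Rminus_0_r in hd.
    specialize (hub _ (regular_polygon_inscribed O r alpha theta n ltac:(lra))).
    fold N in hub. fold h in hub.
    assert (hq : r * Rabs theta * Rabs (sin h / h) <= s).
    { unfold Rdiv. rewrite Rabs_mult, Rabs_inv, <- habs.
      replace (r * (Rabs h * (2 * N)) * (Rabs (sin h) * / Rabs h))
        with (N * (2 * r * Rabs (sin h))) by (field; lra).
      exact hub. }
    apply Rabs_def2 in hd. destruct hd as [_ hd].
    pose proof (Rle_abs (sin h / h)) as hle'.
    pose proof (Rmult_le_compat_l _ _ _ (Rlt_le _ _ hrt) hle').
    pose proof (Rmult_lt_compat_l _ _ _ hrt hd) as hd'.
    replace (r * Rabs theta * - ((r * Rabs theta - s) / (r * Rabs theta)))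
      with (s - r * Rabs theta) in hd' by (field; lra).
    lra.
Qed.

(** Measured from the direction [beta] of [C], perpendicularity becomes [r^2 (cos theta - t) = 0].
    This locates the foot at [t = cos theta], leaving a perpendicular of length [r |sin theta|]. *)
Lemma circle_arc_sine (O : point) (r alpha theta c : R) :
  0 < r ->
  is_arc_sine O (circle_arc O r alpha theta 0) (circle_arc O r alpha theta 1) c ->
  c = r * Rabs (sin theta).
Proof.
  intros hr [F [[[t ->] hperp] ->]].
  unfold perpendicular, circle_arc, distance, dist_euc, fst, snd in *.
  rewrite Rmult_0_l, Rplus_0_r, Rmult_1_l in *.
  set (beta := alpha + theta) in *.
  replace alpha with (beta - theta) in * by (unfold beta; ring).
  pose proof (sin2_cos2 beta) as E. pose proof (sin2_cos2 theta) as E'.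
  unfold Rsqr in E, E'.
  rewrite cos_minus, sin_minus in *.
  set (p := cos beta) in *. set (q := sin beta) in *.
  assert (ht : t = cos theta).
  { match type of hperp with ?lhs = 0 =>
      assert (lhs = r * r * (cos theta - t) * (q * q + p * p)) as hp by ring end.
    rewrite hperp, E in hp.
    apply (Rmult_eq_reg_l (r * r)); [lra |].
    apply Rgt_not_eq, Rmult_lt_0_compat; lra. }
  replace (r * Rabs (sin theta)) with (Rabs (r * sin theta))
    by (rewrite Rabs_mult, (Rabs_pos_eq r); lra).
  rewrite ht, <- sqrt_Rsqr_abs. f_equal. unfold Rsqr.
  transitivity (r * r * (sin theta * sin theta) * (q * q + p * p)); [ring |].
  rewrite E. ring.
Qed.

Theorem theorem3p5 (O : point) (r alpha theta : R) (A C : point) (s b c : R)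
  (hr : 0 < r)
  (htheta : 0 < Rabs theta < 2 * PI)
  (hA : A = circle_arc O r alpha theta 0)
  (hC : C = circle_arc O r alpha theta 1)
  (hs : is_curve_length (circle_arc O r alpha theta) 0 1 s)
  (hsemi : s < PI * r)
  (hb : b = distance A C)
  (hc : is_arc_sine O A C c) :
  b + 1 / 3 * (b - c) < s /\
  s < b + 1 / 3 * (b - c) * ((4 * b + c) / (2 * b + 3 * c)).
Proof.
  assert (h0 : theta <> 0).
  { intros ->. rewrite Rabs_R0 in htheta. lra. }
  apply circle_arc_length in hs; [| easy | easy].
  subst A C. apply circle_arc_sine in hc; [| easy].
  rewrite distance_circle_arc in hb by lra.
  set (x := Rabs theta / 2).
  (* Since [s = r |theta|], the bound [hsemi] says [|theta| < PI]; hence [cos x] and the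
     denominators below are positive. *)
  assert (hx : 0 < x < PI / 2).
  { assert (Rabs theta < PI) by (apply (Rmult_lt_reg_l r); lra). unfold x. lra. }
  (* Oddness of the sine treats both orientations of the arc at once. *)
  assert (hsin : forall y, 0 <= Rabs y <= PI -> Rabs (sin y) = sin (Rabs y)).
  { intros y hy. rewrite <- (Rabs_pos_eq (sin (Rabs y))) by (apply sin_ge_0; lra).
    unfold Rabs at 3. destruct (Rcase_abs y); [| easy].
    now rewrite sin_neg, Rabs_Ropp. }
  assert (hx2 : Rabs ((1 - 0) * theta / 2) = x).
  { replace ((1 - 0) * theta / 2) with (theta * / 2) by field.
    rewrite Rabs_mult, (Rabs_pos_eq (/ 2)) by lra. reflexivity. }
  rewrite hsin, hx2 in hb by lra.
  rewrite hsin in hc by (unfold x in hx; lra).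
  replace (Rabs theta) with (2 * x) in hs, hc by (unfold x; field).
  rewrite sin_2a in hc.
  pose proof (sin_sub_sin_double_lt x ltac:(lra)) as hlow.
  pose proof (lt_sin_mul_rational_cos x ltac:(lra)) as hup.
  assert (hS : 0 < sin x) by (apply sin_gt_0; lra).
  assert (hk : 0 < cos x) by (apply cos_gt_0; lra).
  subst s b c. split.
  - apply (Rmult_lt_compat_l r) in hlow; lra.
  - apply (Rmult_lt_compat_l (2 * r)) in hup; [| lra].
    (* As [c = b * cos x], a factor [b] cancels in the quotient; this needs [2 b + 3 c] nonzero,
       whence the positivity facts after [field]. *)
    match goal with |- _ < ?rhs =>
      replace rhs with (2 * r * (sin x * (10 + 6 * cos x - cos x ^ 2)
                                 / (6 + 9 * cos x))) end; [lra |].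
    field. repeat split; try lra.
    assert (0 < r * sin x) by now apply Rmult_lt_0_compat.
    assert (0 < r * sin x * cos x) by now apply Rmult_lt_0_compat.
    lra.
Qed.
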